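(* For $n\in\mathbb{N}$ write $n=2^j m$ with $j\in\mathbb{N}\cup\{0\}$ and $m$ odd. Then $$\sum_{\substack{k=1\\ \gcd(k,n)=1}}^n c_n(k^2-1)=\begin{cases} d_j\,\psi(m), & \text{if } j\in\{0,1,2,3\} \text{ and } m \text{ is squarefree},\\ 0,&\text{otherwise},\end{cases}$$ where $d_0=d_1=1$, $d_2=4$, $d_3=16$.
   Context: For $n\in\mathbb{N}$ and $k\in\mathbb{Z}$, $c_n(k)=\sum_{1\le j\le n,\ \gcd(j,n)=1}\exp(2\pi i jk/n)$ is the Ramanujan sum. $\psi(n)=n\prod_{p\mid n}(1+1/p)$ is the Dedekind function. *)

(* Defs.v *)
From mathcomp Require Export all_boot all_order all_algebra.
From mathcomp Require Export reals sequences exp trigo.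
From mathcomp Require Export complex.
Set Implicit Arguments.
Unset Strict Implicit.
Unset Printing Implicit Defensive.
Import GRing.Theory Num.Theory.
Local Open Scope ring_scope.
Local Open Scope complex_scope.

Definition cexp (R : realType) (z : R[i]) : R[i] :=
  let: a +i* b := z in (expR a)%:C * (cos b +i* sin b).

Definition ramanujan_sum (R : realType) (n : nat) (k : int) : R[i] :=
  \sum_(1 <= j < n.+1 | coprime j n)
    cexp (2 * pi%:C * 'i%C * j%:R * k%:~R / n%:R).

Definition dedekind_psi (F : fieldType) (n : nat) : F :=
  n%:R * \prod_(p <- primes n) (1 + p%:R^-1).

Definition squarefree (n : nat) : Prop :=
  forall d : nat, (d ^ 2 %| n)%N -> d = 1%N.

(* Only the values at j <= 3 are meaningful. *)
Definition d_coef (j : nat) : nat := nth 0%N [:: 1; 1; 4; 16]%N j.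

(* Main.v *)
(** Put z = exp(2 pi i / n). The sum is S(n, z), the sum over residues k coprime
    to n of c(n, z^(k^2 - 1)), where c(n, y) is the sum of y^j over residues j
    coprime to n.

    Suppose that d^2 | n with d > 2, and put s = n / d. Then n divides s^2 but
    not 2 s. Since n | s^2, translation by t s permutes the residues coprime
    to n, and it multiplies x^(k^2) by w^(k t), where w = x^(2 s). If x is a
    primitive n-th root of unity, then w^k <> 1 for k coprime to n, so averaging
    over t < n shows that the sum of x^(k^2) vanishes. Taking x = z^j for all j
    coprime to n gives S(n, z) = 0. Such a d exists unless n = 2^j m with j <= 3
    and m squarefree: take d = 4 if j > 3.

    In the remaining case the Chinese remainder theorem makes S multiplicative:
    S(a b, y z) = S(a, y) S(b, z) for coprime a and b. For an odd prime p,
    c(p, y) is p - 1 if y = 1 and -1 otherwise, and k^2 = 1 has two solutions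
    modulo p, so S(p, z) = 2 p - (p - 1) = p + 1. If j <= 3 then all odd squares
    are 1 modulo 2^j, so S(2^j, z) = totient(2^j)^2. *)
Require Import Defs.
From mathcomp Require Import boolp zify ring lra.
Set Implicit Arguments.
Unset Strict Implicit.
Import GRing.Theory Num.Theory.
Local Open Scope ring_scope.
Local Open Scope complex_scope.

Definition periodic_mod (T : Type) (n : nat) (f : nat -> T) : Prop :=
  forall k, f (k %% n)%N = f k.

Lemma coprime_periodic (n : nat) : periodic_mod n (coprime^~ n).
Proof. by move=> k; rewrite coprime_modl. Qed.

Lemma expr_periodic (R : nzRingType) (n : nat) (z : R) :
  z ^+ n = 1 -> periodic_mod n (GRing.exp z).
Proof. by move=> zn k; apply: expr_mod. Qed.

Lemma expr_sqr_periodic (R : nzRingType) (n : nat) (z : R) :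
  z ^+ n = 1 -> periodic_mod n (fun k => z ^+ (k ^ 2)).
Proof. by move=> zn k; rewrite -(expr_mod _ zn) modnXm expr_mod. Qed.

Lemma sum_periodic_shift (V : nmodType) (n s : nat) (P : pred nat)
    (f : nat -> V) :
    periodic_mod n P -> periodic_mod n f ->
  \sum_(k < n | P (k + s)%N) f (k + s)%N = \sum_(k < n | P k) f k.
Proof.
case: n => [|n] P_per f_per; first by rewrite !big_ord0.
pose shift (k : 'I_n.+1) : 'I_n.+1 := inord ((k + s) %% n.+1).
have shiftE k : shift k = ((k + s) %% n.+1)%N :> nat.
  by rewrite inordK ?ltn_pmod.
have shift_inj : injective shift.
  move=> x y /(congr1 (@nat_of_ord _)); rewrite !shiftE => /eqP.
  by rewrite eqn_modDr !modn_small // => /eqP/val_inj.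
rewrite [RHS](reindex_inj shift_inj).
by apply: eq_big => k; rewrite shiftE ?P_per ?f_per.
Qed.

Lemma sum_nat1_periodic (V : nmodType) (n : nat) (P : pred nat) (f : nat -> V) :
    periodic_mod n P -> periodic_mod n f ->
  \sum_(1 <= k < n.+1 | P k) f k = \sum_(k < n | P k) f k.
Proof.
move=> P_per f_per; rewrite -(sum_periodic_shift 1 P_per f_per).
by rewrite big_add1 big_mkord; apply: eq_big => k; rewrite addn1.
Qed.

Lemma sum_coprime_prime (V : nmodType) (p : nat) (f : nat -> V) :
  prime p -> \sum_(k < p | coprime k p) f k = \sum_(1 <= k < p) f k.
Proof.
move=> pp; rewrite -(big_mkord (coprime^~ p)) big_ltn_cond ?prime_gt0 //.
rewrite /coprime gcd0n gtn_eqF ?prime_gt1 // big_nat_cond [RHS]big_nat_cond.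
apply: eq_bigl => k; rewrite andbT; apply: andb_idr => /andP[k0 kp].
by rewrite -/(coprime k p) coprime_sym prime_coprime // gtnNdvd.
Qed.

Lemma sum_coprimeM (R : comNzRingType) (a b : nat) (f g : nat -> R) :
    (0 < a)%N -> (0 < b)%N -> coprime a b ->
    periodic_mod a f -> periodic_mod b g ->
  \sum_(k < a * b | coprime k (a * b)) f k * g k =
  (\sum_(k < a | coprime k a) f k) * (\sum_(k < b | coprime k b) g k).
Proof.
move=> a0 b0 cab f_per g_per; rewrite big_distrlr /= pair_big /=.
have ab0 : (0 < a * b)%N by rewrite muln_gt0 a0.
pose crt (x : 'I_a * 'I_b) : 'I_(a * b) :=
  Ordinal (ltn_pmod (chinese a b x.1 x.2) ab0).
pose residues (k : 'I_(a * b)) : 'I_a * 'I_b :=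
  (Ordinal (ltn_pmod k a0), Ordinal (ltn_pmod k b0)).
have crt_modl x : (crt x %% a = x.1)%N.
  by rewrite /= modn_dvdm ?dvdn_mulr // chinese_modl // modn_small.
have crt_modr x : (crt x %% b = x.2)%N.
  by rewrite /= modn_dvdm ?dvdn_mull // chinese_modr // modn_small.
have residuesK : cancel residues crt.
  by move=> k; apply: val_inj; rewrite /= -chinese_mod // modn_small.
have crtK : cancel crt residues.
  move=> x; have := crt_modl x; have := crt_modr x; rewrite /residues.
  by case: x => x y /= hy hx; congr (_, _); apply: val_inj.
rewrite (reindex crt) /=; last by exists residues.
apply: eq_big => [x|x _].
  rewrite coprimeMr -(coprime_modl _ a) -(coprime_modl _ b).
  by rewrite crt_modl crt_modr.
by rewrite -f_per -g_per crt_modl crt_modr.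
Qed.

Lemma sum_expr_unity_root (R : idomainType) (n : nat) (y : R) :
  y ^+ n = 1 -> y != 1 -> \sum_(t < n) y ^+ t = 0.
Proof.
move=> yn yN1; apply/eqP; have := subrX1 y n.
by rewrite yn subrr => /esym/eqP; rewrite mulf_eq0 subr_eq0 (negPf yN1).
Qed.

(** * Sums over the residues coprime to the modulus *)

Definition coprime_expr_sum (R : nzSemiRingType) (n : nat) (y : R) : R :=
  \sum_(j < n | coprime j n) y ^+ j.

Lemma coprime_expr_sum1 (R : nzSemiRingType) (n : nat) :
  coprime_expr_sum n 1 = (totient n)%:R :> R.
Proof.
rewrite totient_count_coprime big_mkord natr_sum /coprime_expr_sum big_mkcond.
by apply: eq_bigr => j _; rewrite expr1n coprime_sym; case: coprime.
Qed.

Lemma coprime_expr_sumM (R : comNzRingType) (a b : nat) (y z : R) :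
    (0 < a)%N -> (0 < b)%N -> coprime a b -> y ^+ a = 1 -> z ^+ b = 1 ->
  coprime_expr_sum (a * b) (y * z) =
  coprime_expr_sum a y * coprime_expr_sum b z.
Proof.
move=> a0 b0 cab ya zb.
rewrite -(sum_coprimeM a0 b0 cab (expr_periodic ya) (expr_periodic zb)).
by apply: eq_bigr => j _; rewrite exprMn.
Qed.

Lemma coprime_expr_sum_prime (R : idomainType) (p : nat) (y : R) :
    prime p -> y ^+ p = 1 ->
  coprime_expr_sum p y = p%:R * (y == 1)%:R - 1.
Proof.
move=> pp yp; rewrite /coprime_expr_sum sum_coprime_prime //.
apply/eqP; rewrite eq_sym subr_eq addrC; apply/eqP.
rewrite -[1 in RHS](expr0 y) -big_ltn ?prime_gt0 // big_mkord.
case: eqVneq => [->|yN1]; last by rewrite mulr0 sum_expr_unity_root.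
by under eq_bigr do rewrite expr1n; rewrite sumr_const card_ord mulr1.
Qed.

Definition square_unit_sum (F : fieldType) (n : nat) (z : F) : F :=
  \sum_(k < n | coprime k n) coprime_expr_sum n (z ^+ (k ^ 2) / z).

Lemma expr_div_unity_root (F : fieldType) (n i : nat) (z : F) :
  z ^+ n = 1 -> (z ^+ i / z) ^+ n = 1.
Proof. by move=> zn; rewrite expr_div_n exprAC zn expr1n divr1. Qed.

Lemma coprime_expr_sum_sqr_periodic (F : fieldType) (n : nat) (z : F) :
    z ^+ n = 1 ->
  periodic_mod n (fun k => coprime_expr_sum n (z ^+ (k ^ 2) / z)).
Proof. by move=> zn k; rewrite (expr_sqr_periodic zn). Qed.

Lemma square_unit_sumM (F : fieldType) (a b : nat) (y z : F) :
    (0 < a)%N -> (0 < b)%N -> coprime a b -> y ^+ a = 1 -> z ^+ b = 1 ->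
  square_unit_sum (a * b) (y * z) = square_unit_sum a y * square_unit_sum b z.
Proof.
move=> a0 b0 cab ya zb.
have := sum_coprimeM a0 b0 cab (coprime_expr_sum_sqr_periodic ya)
  (coprime_expr_sum_sqr_periodic zb).
rewrite /square_unit_sum => <-; apply: eq_bigr => k _.
by rewrite exprMn invfM mulrACA coprime_expr_sumM ?expr_div_unity_root.
Qed.

Lemma prim_root_expr_crt (R : nzRingType) (a b c : nat) (z : R) :
    (a * b).-primitive_root z -> c = 1 %[mod a] -> c = 0 %[mod b] ->
  a.-primitive_root (z ^+ c).
Proof.
move=> pz c1 c0; have := prim_order_gt0 pz; rewrite muln_gt0 => /andP[_ b0].
have ca : coprime c a by rewrite -coprime_modl c1 coprime_modl coprime1n.
have := exp_prim_root pz c.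
by rewrite Gauss_gcdr // -gcdn_modl c0 mod0n gcd0n mulnK.
Qed.

Lemma prim_root_coprime_split (R : nzRingType) (a b : nat) (z : R) :
    coprime a b -> (a * b).-primitive_root z ->
  exists x y : R, [/\ a.-primitive_root x, b.-primitive_root y & z = x * y].
Proof.
move=> cab pz; pose c := chinese a b 1 0; pose d := chinese a b 0 1.
have [c1 c0] : c = 1 %[mod a] /\ c = 0 %[mod b].
  by rewrite chinese_modl ?chinese_modr.
have [d0 d1] : d = 0 %[mod a] /\ d = 1 %[mod b].
  by rewrite chinese_modl ?chinese_modr.
exists (z ^+ c), (z ^+ d); split.
- exact: prim_root_expr_crt pz c1 c0.
- by apply: prim_root_expr_crt d1 d0; rewrite mulnC.
rewrite -exprD -[LHS]expr1; apply/eqP.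
rewrite (eq_prim_root_expr pz) chinese_remainder //.
by rewrite -modnDm c1 d0 modnDm -(modnDm c) c0 d1 modnDm !eqxx.
Qed.

(** * Odd primes and powers of two *)

Lemma sqrn_eq1_mod_prime (p k : nat) :
    prime p -> (0 < k < p)%N ->
  (k ^ 2 == 1 %[mod p]) = (k == 1%N) || (k == p.-1).
Proof.
move=> pp /andP[k0 kp].
rewrite eqn_mod_dvd ?expn_gt0 ?k0 // -[X in (_ - X)%N](exp1n 2) subn_sqr.
rewrite Euclid_dvdM //; congr (_ || _); apply/idP/eqP.
- by move/dvdnP=> [[|q]]; lia.
- by move->.
- by move/dvdnP=> [[|[|q]]]; lia.
- by move->; rewrite addn1 prednK ?dvdnn // prime_gt0.
Qed.

Lemma count_sqrn_eq1_mod_prime (p : nat) :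
  prime p -> odd p -> (\sum_(1 <= k < p) (k ^ 2 == 1 %[mod p]) = 2)%N.
Proof.
move=> pp op; have p3 : (2 < p)%N by rewrite odd_prime_gt2.
under eq_big_nat => k k_bd do rewrite sqrn_eq1_mod_prime //.
rewrite big_ltn 1?ltnW //= -(ltn_predK p3) big_nat_recr /=; last by lia.
rewrite eqxx orbT big_nat_cond big1 // => k; lia.
Qed.

Lemma square_unit_sum_prime (F : fieldType) (p : nat) (z : F) :
  prime p -> odd p -> p.-primitive_root z -> square_unit_sum p z = p.+1%:R.
Proof.
move=> pp op pz; have zp := prim_expr_order pz.
have z0 : z != 0 by rewrite (prim_root_eq0 pz) -lt0n prime_gt0.
have ratio_eq1 k : (z ^+ (k ^ 2) / z == 1) = (k ^ 2 == 1 %[mod p]).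
  rewrite -(eq_prim_root_expr pz) expr1 -[in LHS](divff z0).
  by rewrite (inj_eq (mulIf _)) ?invr_eq0.
have summandE k : coprime_expr_sum p (z ^+ (k ^ 2) / z) =
    p%:R * (k ^ 2 == 1 %[mod p])%:R - 1.
  by rewrite coprime_expr_sum_prime ?ratio_eq1 ?expr_div_unity_root.
transitivity (\sum_(1 <= k < p) (p%:R * (k ^ 2 == 1 %[mod p])%:R - 1 : F)).
  by rewrite -sum_coprime_prime //; apply: eq_bigr => k _; apply: summandE.
rewrite sumrB -big_distrr -natr_sum count_sqrn_eq1_mod_prime //.
rewrite sumr_const_nat subn1 -(prednK (prime_gt0 pp)) /=; ring.
Qed.

Lemma square_unit_sum_sqr_eq1 (F : fieldType) (n : nat) (z : F) :
    (forall k, coprime k n -> k ^ 2 = 1 %[mod n]) -> n.-primitive_root z ->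
  square_unit_sum n z = (totient n ^ 2)%:R.
Proof.
move=> sqr1 pz; have zn := prim_expr_order pz.
have z0 : z != 0 by rewrite (prim_root_eq0 pz) -lt0n (prim_order_gt0 pz).
transitivity (\sum_(k < n | coprime k n) 1 ^+ k * coprime_expr_sum n 1 : F).
  apply: eq_bigr => k ck; rewrite expr1n mul1r.
  by rewrite -(expr_mod _ zn) sqr1 // expr_mod // divff.
by rewrite -big_distrl -/(coprime_expr_sum n 1) coprime_expr_sum1 natrX expr2.
Qed.

Lemma sqrn_odd_mod8 (k : nat) : odd k -> k ^ 2 = 1 %[mod 8].
Proof.
rewrite -modnXm -(@odd_mod k 8) //.
by have := ltn_pmod k (isT : 0 < 8)%N; move: (k %% 8)%N; do 8 case=> //.
Qed.

Lemma sqrn_coprime_mod_two_pow (j k : nat) :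
  (j <= 3)%N -> coprime k (2 ^ j) -> k ^ 2 = 1 %[mod 2 ^ j].
Proof.
case: j => [|j] j3 ck; first by rewrite !modn1.
have dvd8 : (2 ^ j.+1 %| 8)%N by apply: (@dvdn_exp2l 2 _ 3).
rewrite -(modn_dvdm _ dvd8) sqrn_odd_mod8 ?modn_dvdm //.
by rewrite -coprimen2 -(coprime_pexpr _ _ (ltn0Sn j)).
Qed.

Lemma square_unit_sum_two_pow (F : fieldType) (j : nat) (z : F) :
    (j <= 3)%N -> (2 ^ j).-primitive_root z ->
  square_unit_sum (2 ^ j) z = (d_coef j)%:R.
Proof.
move=> j3 pz; rewrite square_unit_sum_sqr_eq1 // => [|k]; last first.
  exact: sqrn_coprime_mod_two_pow.
by congr _%:R; move: j3 {pz}; do 4 ?[case: j => [|j]].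
Qed.

(** * Squarefree odd part *)

Lemma squarefree_dvd (d m : nat) : (d %| m)%N -> squarefree m -> squarefree d.
Proof. by move=> dm sqf e ed; apply: sqf; apply: dvdn_trans dm. Qed.

Lemma squarefree_coprime (a b : nat) : squarefree (a * b) -> coprime a b.
Proof.
by move=> sqf; apply/eqP/sqf; rewrite dvdn_mul ?dvdn_gcdl ?dvdn_gcdr.
Qed.

Lemma dedekind_psi_prime (F : fieldType) (p : nat) :
  prime p -> p%:R != 0 :> F -> dedekind_psi F p = p.+1%:R.
Proof.
move=> pp p0; rewrite /dedekind_psi primes_prime // big_seq1.
by rewrite mulrDr mulr1 divff // natr1.
Qed.

Lemma dedekind_psiM (F : fieldType) (a b : nat) :
    (0 < a)%N -> (0 < b)%N -> coprime a b ->
  dedekind_psi F (a * b) = dedekind_psi F a * dedekind_psi F b.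
Proof.
move=> a0 b0 cab; rewrite /dedekind_psi.
have /(perm_big _)-> : perm_eq (primes (a * b)) (primes a ++ primes b).
  apply: uniq_perm => [||p]; rewrite ?primes_uniq //; last first.
    by rewrite primesM // mem_cat.
  by rewrite cat_uniq !primes_uniq -coprime_has_primes ?cab.
by rewrite big_cat natrM mulrACA.
Qed.

Lemma square_unit_sum_squarefree (F : fieldType) (m : nat) (z : F) :
    odd m -> squarefree m -> m.-primitive_root z ->
  square_unit_sum m z = dedekind_psi F m.
Proof.
elim/ltn_ind: m z => m IH z om sqf pz.
have [m1|m1] := leqP m 1.
  have m1' : m = 1%N by case: m m1 om {IH sqf pz} => [|[]].
  rewrite m1' in pz *; rewrite (@square_unit_sum_two_pow _ 0) //.
  by rewrite /dedekind_psi big_nil mulr1.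
have [r] := dvdnP (pdiv_dvd m); move: (pdiv m) (pdiv_prime m1) => p pp.
rewrite mulnC => def_m; subst m; move: om; rewrite oddM => /andP[op or].
have p1 := prime_gt1 pp; have r0 := odd_gt0 or.
have cpr := squarefree_coprime sqf.
have [x [y [px py ->]]] := prim_root_coprime_split cpr pz.
rewrite square_unit_sumM ?prim_expr_order ?(ltnW p1) //.
rewrite square_unit_sum_prime // IH //; first last.
- exact: squarefree_dvd (dvdn_mull _ _) sqf.
- by rewrite ltn_Pmull.
rewrite dedekind_psiM ?(ltnW p1) // (dedekind_psi_prime pp) //.
exact: prim_root_natf_neq0 px.
Qed.

Lemma square_unit_sum_two_pow_squarefree (F : fieldType) (j m : nat) (z : F) :
    (j <= 3)%N -> odd m -> squarefree m -> (2 ^ j * m).-primitive_root z ->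
  square_unit_sum (2 ^ j * m) z = (d_coef j)%:R * dedekind_psi F m.
Proof.
move=> j3 om sqf pz.
have cjm : coprime (2 ^ j) m by rewrite coprimeXl ?coprime2n.
have [x [y [px py ->]]] := prim_root_coprime_split cjm pz.
rewrite square_unit_sumM ?prim_expr_order ?expn_gt0 ?(odd_gt0 om) //.
by rewrite square_unit_sum_two_pow // square_unit_sum_squarefree.
Qed.

(** * Moduli with a square divisor *)

Lemma coprime_addr_dvd_sqr (n s k : nat) :
  (0 < n)%N -> (n %| s ^ 2)%N -> coprime (k + s) n = coprime k n.
Proof.
move=> n0; have coprime_sub i r :
    (n %| r ^ 2)%N -> coprime (i + r) n -> coprime i n.
  move=> nr; rewrite -(coprime_pexpl _ _ (isT : 0 < 2)%N).
  have -> : ((i + r) ^ 2 = i * (i + 2 * r) + r ^ 2)%N by lia.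
  rewrite -coprime_modl -modnDmr (eqP nr) addn0 coprime_modl coprimeMl.
  by case/andP.
move=> ns; apply/idP/idP; first exact: coprime_sub.
move=> ck; apply: (@coprime_sub _ (n.-1 * s)).
  by rewrite expnMn dvdn_mull.
rewrite -addnA -mulSn prednK // mulnC addnC.
by rewrite -coprime_modl modnMDl coprime_modl.
Qed.

Lemma sum_coprime_expr_sqr_eq0 (F : fieldType) (n s : nat) (x : F) :
    n.-primitive_root x -> (n %| s ^ 2)%N -> ~~ (n %| 2 * s)%N ->
  \sum_(k < n | coprime k n) x ^+ (k ^ 2) = 0.
Proof.
move=> px ns n2s; have xn := prim_expr_order px.
set S := LHS; pose w := x ^+ (2 * s).
have wn : w ^+ n = 1 by rewrite /w exprAC xn expr1n.
have shift t : S = \sum_(k < n | coprime k n) x ^+ (k ^ 2) * (w ^+ k) ^+ t.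
  rewrite /S -(sum_periodic_shift (t * s) (coprime_periodic n)
    (expr_sqr_periodic xn)).
  apply: eq_big => [k|k _].
    by rewrite coprime_addr_dvd_sqr ?(prim_order_gt0 px) // expnMn dvdn_mull.
  have -> : ((k + t * s) ^ 2 = t ^ 2 * s ^ 2 + (k ^ 2 + 2 * s * k * t))%N.
    by lia.
  rewrite exprD -(expr_mod _ xn) (eqP (dvdn_mull _ ns)) mul1r exprD.
  by rewrite !(exprM x (2 * s * k)) !(exprM x (2 * s)).
have : \sum_(t < n) S = 0.
  under eq_bigr => t _ do rewrite (shift t).
  rewrite exchange_big big1 //= => k ck; rewrite -big_distrr /=.
  rewrite sum_expr_unity_root ?mulr0 //.
    by rewrite exprAC wn expr1n.
  by rewrite -exprM -(prim_order_dvd px) Gauss_dvdl // coprime_sym.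
rewrite sumr_const card_ord -mulr_natr => /eqP.
by rewrite mulf_eq0 (negPf (prim_root_natf_neq0 px)) orbF => /eqP.
Qed.

Lemma square_unit_sum_eq0 (F : fieldType) (n d : nat) (z : F) :
    (2 < d)%N -> (d ^ 2 %| n)%N -> n.-primitive_root z ->
  square_unit_sum n z = 0.
Proof.
move=> d2 /dvdnP[e def_n] pz; have n0 := prim_order_gt0 pz.
have n_dvd_sqr : (n %| (e * d) ^ 2)%N by apply/dvdnP; exists e; lia.
have n_ndvd_double : ~~ (n %| 2 * (e * d))%N by rewrite gtnNdvd //; nia.
rewrite /square_unit_sum exchange_big big1 //= => j cj.
transitivity ((\sum_(k < n | coprime k n) (z ^+ j) ^+ (k ^ 2)) / z ^+ j).
  by rewrite big_distrl; apply: eq_bigr => k _; rewrite expr_div_n exprAC.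
rewrite (sum_coprime_expr_sqr_eq0 _ n_dvd_sqr) ?mul0r //.
by rewrite prim_root_exp_coprime.
Qed.

Lemma not_squarefree_sqr_dvdn (j m : nat) :
    odd m -> ~ ((j <= 3)%N /\ squarefree m) ->
  exists2 d, (2 < d)%N & (d ^ 2 %| 2 ^ j * m)%N.
Proof.
move=> om not_sqf; have [j3|j4] := leqP j 3; last first.
  by exists 4 => //; rewrite dvdn_mulr // (dvdn_exp2l 2 j4).
have /existsNP[d /not_implyP[dm d1]] : ~ squarefree m.
  by move=> sqf; apply: not_sqf.
exists d; last by rewrite dvdn_mull.
by move: d1 (dvdn_odd dm om); rewrite oddX; case: d {dm} => [|[|[]]].
Qed.

(** * The complex exponential and Ramanujan sums *)

Lemma cexpD (R : realType) (x y : R[i]) : cexp (x + y) = cexp x * cexp y.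
Proof.
case: x y => [a b] [c d]; rewrite /cexp /= expRD cosD sinD.
apply/eqP; rewrite eq_complex /=; apply/andP; split; apply/eqP; ring.
Qed.

Lemma cexp0 (R : realType) : cexp (0 : R[i]) = 1.
Proof. by rewrite /cexp /= expR0 cos0 sin0 mul1r. Qed.

Lemma cexp_imaginary (R : realType) (t : R) :
  cexp (0 +i* t) = cos t +i* sin t.
Proof. by rewrite /cexp expR0 mul1r. Qed.

Lemma cexpMn (R : realType) (x : R[i]) (n : nat) : cexp (x *+ n) = cexp x ^+ n.
Proof.
by elim: n => [|n IH]; rewrite ?mulr0n ?cexp0 // mulrS cexpD IH exprS.
Qed.

Lemma cexpN (R : realType) (x : R[i]) : cexp (- x) = (cexp x)^-1.
Proof. by apply/esym/mulr1_eq; rewrite -cexpD subrr cexp0. Qed.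

Lemma cexpMz (R : realType) (x : R[i]) (k : int) : cexp (x *~ k) = cexp x ^ k.
Proof.
by case: k => n; rewrite ?NegzE ?mulrNz ?cexpN -pmulrn cexpMn ?exprN.
Qed.

Lemma cos_neq1 (R : realType) (x : R) : 0 < x < pi *+ 2 -> cos x != 1.
Proof.
move=> x_bd; have half_bd : 0 < x / 2 < pi by lra.
have -> : x = (x / 2) *+ 2 by lra.
rewrite cos_mulr2n cos2sin2; have := sin_gt0_pi half_bd; nra.
Qed.

Definition root_of_unity (R : realType) (n : nat) : R[i] :=
  cexp (2 * pi%:C * 'i%C / n%:R).

Lemma root_of_unity_expr (R : realType) (n k : nat) :
  root_of_unity R n ^+ k = cexp (0 +i* (pi *+ 2 * (k%:R / n%:R))).
Proof.
rewrite -cexpMn; congr cexp.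
rewrite [RHS]complexE /= !rmorphM rmorphMn fmorphV !rmorph_nat add0r; ring.
Qed.

Lemma root_of_unity_primitive (R : realType) (n : nat) :
  (0 < n)%N -> n.-primitive_root (root_of_unity R n).
Proof.
move=> n0; have nR0 : 0 < n%:R :> R by rewrite ltr0n.
have tau0 : 0 < pi *+ 2 :> R by rewrite pmulrn_lgt0 ?pi_gt0.
apply/andP; split => //; apply/forallP => k; rewrite unity_rootE; apply/eqP.
rewrite root_of_unity_expr cexp_imaginary; have [->|kn] := eqVneq k.+1 n.
  by rewrite divff ?lt0r_neq0 // mulr1 cos2pi sin2pi eqxx.
rewrite eq_complex /= (negPf (cos_neq1 _)) // gtr_pMr //.
rewrite mulr_gt0 ?divr_gt0 ?ltr0n //= ltr_pdivrMr // mul1r ltr_nat.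
by rewrite ltn_neqAle kn ltn_ord.
Qed.

Lemma ramanujan_sumE (R : realType) (n : nat) (k : int) : (0 < n)%N ->
  ramanujan_sum R n k = coprime_expr_sum n (root_of_unity R n ^ k).
Proof.
move=> n0; have zn := prim_expr_order (root_of_unity_primitive R n0).
have zkn : (root_of_unity R n ^ k) ^+ n = 1.
  by rewrite exprnP exprzAC -exprnP zn exp1rz.
rewrite /coprime_expr_sum.
rewrite -(sum_nat1_periodic (coprime_periodic n) (expr_periodic zkn)).
apply: eq_bigr => j _; rewrite -cexpMz -cexpMn; congr cexp.
rewrite -mulr_natr -mulrzr; ring.
Qed.

Lemma sum_ramanujan_sum_sqr_pred (R : realType) (n : nat) : (0 < n)%N ->
  \sum_(1 <= k < n.+1 | coprime k n) ramanujan_sum R n (k%:Z ^+ 2 - 1) =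
  square_unit_sum n (root_of_unity R n).
Proof.
move=> n0; have pz := root_of_unity_primitive R n0.
have z0 : root_of_unity R n != 0 by rewrite (prim_root_eq0 pz) -lt0n.
have summand_per := coprime_expr_sum_sqr_periodic (prim_expr_order pz).
rewrite /square_unit_sum -(sum_nat1_periodic (coprime_periodic n) summand_per).
by apply: eq_bigr => k _; rewrite ramanujan_sumE // expfzDr // -natrX.
Qed.

Unset Implicit Arguments.

Theorem corollary11 (R : realType) (n j m : nat)
    (hn : n = (2 ^ j * m)%N) (hm : odd m) :
  ((j <= 3)%N /\ squarefree m ->
     \sum_(1 <= k < n.+1 | coprime k n) ramanujan_sum R n (k%:Z ^+ 2 - 1)
       = (d_coef j)%:R * dedekind_psi R[i] m) /\
  (~ ((j <= 3)%N /\ squarefree m) ->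
     \sum_(1 <= k < n.+1 | coprime k n) ramanujan_sum R n (k%:Z ^+ 2 - 1)
       = 0).
Proof.
have n0 : (0 < n)%N by rewrite hn muln_gt0 expn_gt0 (odd_gt0 hm).
have := root_of_unity_primitive R n0.
rewrite sum_ramanujan_sum_sqr_pred // hn => pz; split=> [[j3 sqf]|not_sqf].
  exact: square_unit_sum_two_pow_squarefree.
have [d d2 d_sqr] := not_squarefree_sqr_dvdn hm not_sqf.
exact: square_unit_sum_eq0 d2 d_sqr pz.
Qed.
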